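(* Let $X$ be a complete semitopological semilattice satisfying the separation axiom $\vec{T}_{2\delta}$. Then the partial order $\{(x,y)\in X\times X: xy=x\}$ of $X$ is a closed subset of $X\times X$ (with the product topology).
   Context: A semilattice is a commutative semigroup all of whose elements are idempotents ($xx=x$). It carries the natural partial order $x\le y$ iff $xy=x$ $(=yx)$. A subset $C$ of a semilattice is a chain if $xy\in\{x,y\}$ for all $x,y\in C$. A topologized semilattice is a semilattice endowed with a topology (no compatibility and no separation axiom assumed). A semitopological semilattice is a topologized semilattice $X$ whose operation $X\times X\to X$, $(x,y)\mapsto xy$, is separately continuous, i.e. for every $a\in X$ the shift $x\mapsto ax$ is continuous. A topologized semilattice $X$ is complete if each non-empty chain $C\subset X$ has an infimum $\inf C$ and a supremum $\sup C$ in the partially ordered set $(X,\le)$, and $\inf C\in\bar C$ and $\sup C\in\bar C$, where $\bar C$ is the closure of $C$ in $X$. A topological space $Z$ satisfies the separation axiom $T_1$ if for any distinct points $x,y\in Z$ there is an open set $U\subset Z$ with $x\in U$ and $y\notin U$. A topological space $Z$ satisfies the separation axiom $T_{2\delta}$ if $Z$ is a $T_1$-space and for any open set $U\subset Z$ and any point $x\in U$ there exists a countable family $\mathcal U$ of closed neighborhoods of $x$ in $Z$ such that $\bigcap\mathcal U\subset U$. A topological space $Z$ satisfies the separation axiom $\vec{T}_{2\delta}$ if $Z$ admits a bijective continuous map $Z\to W$ onto some topological space $W$ satisfying $T_{2\delta}$. *)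

(* Defs.v *)
From mathcomp Require Import all_boot.
From mathcomp Require Import boolp classical_sets cardinality topology.

Set Implicit Arguments.
Unset Strict Implicit.
Unset Printing Implicit Defensive.

Local Open Scope classical_set_scope.

Record is_semilattice (X : Type) (op : X -> X -> X) : Prop := IsSemilattice {
  semilattice_assoc : associative op;
  semilattice_comm : commutative op;
  semilattice_idem : idempotent_op op
}.

Definition semilattice_le (X : Type) (op : X -> X -> X) (x y : X) : Prop :=
  op x y = x.

Definition semilattice_chain (X : Type) (op : X -> X -> X) (C : set X) : Prop :=
  forall x y, C x -> C y -> op x y = x \/ op x y = y.

Definition is_infimum (X : Type) (le : X -> X -> Prop) (C : set X) (m : X) :
    Prop :=
  (forall x, C x -> le m x) /\
  (forall z, (forall x, C x -> le z x) -> le z m).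

Definition is_supremum (X : Type) (le : X -> X -> Prop) (C : set X) (m : X) :
    Prop :=
  (forall x, C x -> le x m) /\
  (forall z, (forall x, C x -> le x z) -> le m z).

Definition separately_continuous (X : topologicalType) (op : X -> X -> X) :
    Prop :=
  (forall a, continuous (fun x : X => op a x)) /\
  (forall a, continuous (fun x : X => op x a)).

Record is_semitopological_semilattice (X : topologicalType)
    (op : X -> X -> X) : Prop := IsSemitopologicalSemilattice {
  semitop_semilattice : is_semilattice op;
  semitop_continuous : separately_continuous op
}.

Definition complete_semilattice (X : topologicalType) (op : X -> X -> X) :
    Prop :=
  forall C : set X, C !=set0 -> semilattice_chain op C ->
    (exists m, is_infimum (semilattice_le op) C m /\ closure C m) /\
    (exists m, is_supremum (semilattice_le op) C m /\ closure C m).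

Definition T2delta_space (Z : topologicalType) : Prop :=
  accessible_space Z /\
  forall (U : set Z) (x : Z), open U -> U x ->
    exists F : set (set Z),
      [/\ countable F,
          forall B, F B -> closed B /\ nbhs x B &
          \bigcap_(B in F) B `<=` U].

Definition vecT2delta_space (Z : topologicalType) : Prop :=
  exists (W : topologicalType) (f : Z -> W),
    [/\ bijective f, continuous f & T2delta_space W].

(* Main.v *)
Require Import Defs.
From mathcomp Require Import all_boot.
From mathcomp Require Import boolp classical_sets cardinality topology.

(** Suppose that [(x, y)] lies in the closure of the order although
    [xy <> x]. The separation axiom provides a closed neighborhood [B] of [x]
    and a decreasing sequence [G n] of closed neighborhoods of [xy] whose
    intersection misses [B] ([separated_closed_nbhs]).

    Since [(x, y)] is a limit of comparable pairs, one can choose inductively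
    [a n <= b n], with [a n] near [x] and [b n] near [y], so that all products
    of consecutive terms [a m * ... * a (m + j)] stay in [B], because [xx = x],
    while the products [b m * a m.+1 * ... * a (m.+1 + j)] stay in [G m],
    because [yx = xy] ([exists_window_sequences]).

    Let [z m] and [t m] be the infima over [j] of these two decreasing
    sequences. By completeness [z m] is in [B] and [t m] is in [G m]. The point
    is that the two sequences interlace: [z m <= t m] since [a m <= b m], and
    [t m <= z m.+1] since a product lies below its factors. Hence they have
    one and the same supremum, which by completeness again belongs to [B] and
    to every [G n]: a contradiction ([interlaced_common_sup]).

    Separate continuity suffices because each new pair is chosen after the
    previous ones, so that only shifts by fixed elements have to be
    continuous. *)

Set Implicit Arguments.
Unset Strict Implicit.
Unset Printing Implicit Defensive.

Local Open Scope classical_set_scope.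

(** * The natural order of a semilattice *)

Lemma semilattice_le_trans (X : Type) (op : X -> X -> X) (x y z : X) :
  is_semilattice op -> semilattice_le op x y -> semilattice_le op y z ->
  semilattice_le op x z.
Proof.
by move=> [opA _ _]; rewrite /semilattice_le => xy yz; rewrite -xy -opA yz.
Qed.

Lemma semilattice_le_anti (X : Type) (op : X -> X -> X) (x y : X) :
  is_semilattice op -> semilattice_le op x y -> semilattice_le op y x -> x = y.
Proof. by move=> [_ opC _]; rewrite /semilattice_le => xy yx; rewrite -xy opC. Qed.

Lemma semilattice_le_mulr (X : Type) (op : X -> X -> X) (x y : X) :
  is_semilattice op -> semilattice_le op (op x y) y.
Proof. by move=> [opA _ opI]; rewrite /semilattice_le -opA opI. Qed.

Lemma semilattice_le_mull2 (X : Type) (op : X -> X -> X) (c x y : X) :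
  is_semilattice op -> semilattice_le op x y ->
  semilattice_le op (op c x) (op c y).
Proof.
move=> [opA opC opI]; rewrite /semilattice_le => xy.
by rewrite (opC c y) opA -(opA c x y) xy (opC _ c) opA opI.
Qed.

Lemma semilattice_le_mulr2 (X : Type) (op : X -> X -> X) (c x y : X) :
  is_semilattice op -> semilattice_le op x y ->
  semilattice_le op (op x c) (op y c).
Proof.
move=> sl xy; rewrite (semilattice_comm sl x) (semilattice_comm sl y).
exact: semilattice_le_mull2.
Qed.

Lemma is_supremum_unique (X : Type) (op : X -> X -> X) (C : set X) (s t : X) :
  is_semilattice op -> is_supremum (semilattice_le op) C s ->
  is_supremum (semilattice_le op) C t -> s = t.
Proof.
by move=> sl [us ls] [ut lt]; apply: (semilattice_le_anti sl); auto.
Qed.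

Lemma decreasing_le (X : Type) (op : X -> X -> X) (u : nat -> X) (m n : nat) :
  is_semilattice op -> (forall k, semilattice_le op (u k.+1) (u k)) ->
  m <= n -> semilattice_le op (u n) (u m).
Proof.
move=> sl du; elim: n => [|n IHn].
  by rewrite leqn0 => /eqP ->; exact: (semilattice_idem sl).
rewrite leq_eqVlt => /predU1P[->|]; first exact: (semilattice_idem sl).
by rewrite ltnS => /IHn; exact: (semilattice_le_trans sl) (du n).
Qed.

Lemma increasing_le (X : Type) (op : X -> X -> X) (u : nat -> X) (m n : nat) :
  is_semilattice op -> (forall k, semilattice_le op (u k) (u k.+1)) ->
  m <= n -> semilattice_le op (u m) (u n).
Proof.
move=> sl iu; elim: n => [|n IHn].
  by rewrite leqn0 => /eqP ->; exact: (semilattice_idem sl).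
rewrite leq_eqVlt => /predU1P[->|]; first exact: (semilattice_idem sl).
by rewrite ltnS => /IHn mn; exact: (semilattice_le_trans sl) mn (iu n).
Qed.

Lemma range_chain (X : Type) (op : X -> X -> X) (u : nat -> X) :
  is_semilattice op ->
  (forall m n, m <= n ->
    semilattice_le op (u m) (u n) \/ semilattice_le op (u n) (u m)) ->
  semilattice_chain op (range u).
Proof.
move=> sl cu _ _ [m _ <-] [n _ <-]; have opC := semilattice_comm sl.
have [/cu[]|/ltnW/cu[]] := leqP m n; rewrite /semilattice_le; auto.
- by right; rewrite opC.
- by right; rewrite opC.
Qed.

(** * Monotone sequences in complete semilattices *)

Lemma complete_decreasing_inf (X : topologicalType) (op : X -> X -> X)
    (u : nat -> X) (B : set X) :
  is_semilattice op -> complete_semilattice op -> closed B ->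
  (forall n, semilattice_le op (u n.+1) (u n)) -> (forall n, B (u n)) ->
  exists z, is_infimum (semilattice_le op) (range u) z /\ B z.
Proof.
move=> sl cX clB du Bu.
have [|[z [zinf clz]] _] := cX (range u) (ex_intro _ (u 0) (imageT u 0)).
  by apply: range_chain => // m n mn; right; exact: decreasing_le.
exists z; split=> //; apply: clB; apply: closureS clz.
by move=> _ [n _ <-].
Qed.

Lemma complete_increasing_sup (X : topologicalType) (op : X -> X -> X)
    (u : nat -> X) (B : set X) :
  is_semilattice op -> complete_semilattice op -> closed B ->
  (forall n, semilattice_le op (u n) (u n.+1)) -> (forall n, B (u n)) ->
  exists s, is_supremum (semilattice_le op) (range u) s /\ B s.
Proof.
move=> sl cX clB iu Bu.
have [|_ [s [ssup cls]]] := cX (range u) (ex_intro _ (u 0) (imageT u 0)).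
  by apply: range_chain => // m n mn; left; exact: increasing_le.
exists s; split=> //; apply: clB; apply: closureS cls.
by move=> _ [n _ <-].
Qed.

(** Every tail of [t] is cofinal with [z], so the supremum of [z] is also the
    supremum of each tail of [t], and the [k]-th tail stays in [G k]. *)
Lemma interlaced_common_sup (X : topologicalType) (op : X -> X -> X)
    (z t : nat -> X) (B : set X) (G : nat -> set X) :
  is_semilattice op -> complete_semilattice op ->
  closed B -> (forall n, closed (G n)) ->
  (forall m n, m <= n -> G n `<=` G m) ->
  (forall n, B (z n)) -> (forall n, G n (t n)) ->
  (forall n, semilattice_le op (z n) (t n)) ->
  (forall n, semilattice_le op (t n) (z n.+1)) ->
  exists s, B s /\ forall n, G n s.
Proof.
move=> sl cX clB clG dG Bz Gt zt tz.
have iz n : semilattice_le op (z n) (z n.+1).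
  exact: (semilattice_le_trans sl) (zt n) (tz n).
have it n : semilattice_le op (t n) (t n.+1).
  exact: (semilattice_le_trans sl) (tz n) (zt n.+1).
have [s [ssup Bs]] := complete_increasing_sup sl cX clB iz Bz.
exists s; split=> // k.
have [|n|s' [s'sup Gs']] :=
  @complete_increasing_sup _ _ (fun n => t (k + n)) _ sl cX (clG k).
- by move=> n; rewrite addnS.
- by apply: dG (Gt _); exact: leq_addr.
suff -> : s = s' by [].
apply: (is_supremum_unique sl ssup); case: s'sup => us' ls'; split.
  move=> _ [n _ <-].
  apply: (semilattice_le_trans sl _ (us' (t (k + n)) _)) => //.
  apply: (semilattice_le_trans sl _ (zt _)) => //.
  by apply: increasing_le => //; exact: leq_addl.
move=> v zv; apply: ls' => _ [n _ <-].
by apply: (semilattice_le_trans sl (tz _) (zv _ _)); exists (k + n).+1.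
Qed.

(** * Products of consecutive terms *)

(** The recursion peels off the leftmost factor [a m], since a constraint on
    [a m * s] is a constraint on the product [s] of the later terms. *)
Fixpoint window_product (X : Type) (op : X -> X -> X) (a : nat -> X)
    (m j : nat) : X :=
  if j is i.+1 then op (a m) (window_product op a m.+1 i) else a m.

Lemma window_product_decreasing (X : Type) (op : X -> X -> X) (a : nat -> X)
    (m j : nat) :
  is_semilattice op ->
  semilattice_le op (window_product op a m j.+1) (window_product op a m j).
Proof.
move=> sl; elim: j m => [|j IHj] m.
  by rewrite /= (semilattice_comm sl); exact: semilattice_le_mulr.
exact: (semilattice_le_mull2 _ sl (IHj m.+1)).
Qed.

Lemma window_products_common_limit (X : topologicalType) (op : X -> X -> X)
    (a b : nat -> X) (B : set X) (G : nat -> set X) :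
  is_semilattice op -> complete_semilattice op ->
  closed B -> (forall n, closed (G n)) ->
  (forall m n, m <= n -> G n `<=` G m) ->
  (forall n, semilattice_le op (a n) (b n)) ->
  (forall m j, B (window_product op a m j)) ->
  (forall m j, G m (op (b m) (window_product op a m.+1 j))) ->
  exists s, B s /\ forall n, G n s.
Proof.
move=> sl cX clB clG dG ab Bp Gq.
have /choice[z /all_and2[zinf Bz]] m := complete_decreasing_inf sl cX clB
  (fun j => window_product_decreasing a m j sl) (Bp m).
have /choice[t /all_and2[tinf Gt]] m := complete_decreasing_inf sl cX (clG m)
  (fun j => semilattice_le_mull2 (b m) sl
    (window_product_decreasing a m.+1 j sl)) (Gq m).
apply: (interlaced_common_sup sl cX clB clG dG Bz Gt) => n.
  apply: (tinf n).2 => _ [j _ <-].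
  apply: (semilattice_le_trans sl ((zinf n).1 (window_product op a n j.+1) _)).
    by exists j.+1.
  exact: semilattice_le_mulr2.
apply: (zinf n.+1).2 => _ [j _ <-].
apply: (semilattice_le_trans sl ((tinf n).1 _ _)); first by exists j.
exact: semilattice_le_mulr.
Qed.

(** The constraints on the future are carried by a decreasing sequence of open
    neighborhoods [N n] of [x]. Shrinking [N n] to [N n.+1] so that the
    shifts by [a n] and [b n] map [N n.+1] into [N n] and [V n] respectively,
    one gets by induction on [j] that the product of [a m], ..., [a (m + j)]
    is in [N m].
    For [N n.+1] to contain [x], it suffices that [(a n) x] be in [N n] and
    [(b n) x] in [V n]; these are open conditions, satisfied by the pair
    [(x, y)]. *)
Lemma exists_window_sequences (X : topologicalType) (op : X -> X -> X)
    (x y : X) (U : set X) (V : nat -> set X) :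
  is_semitopological_semilattice op ->
  closure [set p : X * X | op p.1 p.2 = p.1] (x, y) ->
  open U -> U x -> (forall n, open (V n)) -> (forall n, V n (op x y)) ->
  exists a b : nat -> X, [/\
    forall n, semilattice_le op (a n) (b n),
    forall m j, U (window_product op a m j) &
    forall m j, V m (op (b m) (window_product op a m.+1 j))].
Proof.
move=> [sl [cl cr]] clxy oU Ux oV Vxy.
have open_l c (O : set X) : open O -> open [set s | O (op c s)].
  by move=> oO; apply: open_comp => // s _; exact: cl.
have open_r c (O : set X) : open O -> open [set s | O (op s c)].
  by move=> oO; apply: open_comp => // s _; exact: cr.
have /choice[pick pickP] (Nn : set X * nat) : exists p : X * X,
    open Nn.1 -> Nn.1 x ->
    [/\ semilattice_le op p.1 p.2, Nn.1 p.1, Nn.1 (op p.1 x) &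
        V Nn.2 (op p.2 x)].
  case: Nn => N n /=; have [[oN Nx]|nN] := pselect (open N /\ N x); last first.
    by exists (x, x) => oN Nx; case: nN.
  have [|p [ple [[Np Npx] Vp]]] := clxy
    ((N `&` [set s | N (op s x)]) `*` [set s | V n (op s x)]).
    exists (N `&` [set s | N (op s x)], [set s | V n (op s x)]) => //; split.
      apply: open_nbhs_nbhs; split; first exact: openI oN (open_r _ _ oN).
      by split=> //=; rewrite (semilattice_idem sl).
    apply: open_nbhs_nbhs; split; first exact: open_r.
    by rewrite /= (semilattice_comm sl).
  by exists p.
pose fix N n := if n is k.+1 then
  N k `&` [set s | N k (op (pick (N k, k)).1 s)]
      `&` [set s | V k (op (pick (N k, k)).2 s)] else U.
have NP n : open (N n) /\ N n x.
  elim: n => [//|n [oN Nx]].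
  have [_ _ Nax Vbx] := pickP (N n, n) oN Nx.
  by split=> //=; apply: openI; [apply: openI => //|]; exact: open_l.
have NU n : N n `<=` U by elim: n => [//|n IHn] s [[/IHn]].
pose a n := (pick (N n, n)).1; pose b n := (pick (N n, n)).2.
have Np m j : N m (window_product op a m j).
  elim: j m => [|j IHj] m /=.
    by have [oN Nx] := NP m; have [] := pickP (N m, m) oN Nx.
  by have [[_ ]] := IHj m.+1.
exists a, b; split=> [n|m j|m j].
- by have [oN Nx] := NP n; have [] := pickP (N n, n) oN Nx.
- exact: NU (Np m j).
- by have [_ ] := Np m.+1 j.
Qed.

(** * Separation by countably many closed neighborhoods *)

Lemma countable_closed_nbhs_sequence (Z : topologicalType) (x : Z)
    (F : set (set Z)) :
  countable F -> (forall B, F B -> closed B /\ nbhs x B) ->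
  exists G : nat -> set Z, [/\ forall n, closed (G n),
    forall n, nbhs x (G n), forall m n, m <= n -> G n `<=` G m &
    \bigcap_n G n `<=` \bigcap_(B in F) B].
Proof.
move=> /countable_injP[g ginj] FP.
exists (fun n => \bigcap_(B in [set B | F B /\ g B < n]) B); split.
- by move=> n; apply: closed_bigI => B [/FP[]].
- elim=> [|n IHn]; first by apply: filterS filterT => s _ B [].
  (* By injectivity of g, at most one member of the family has code n. *)
  have [[A [FA gA]]|nA] := pselect (exists A, F A /\ g A = n).
    apply: filterS (filterI IHn (FP A FA).2) => s [Gs As] B [FB].
    rewrite ltnS leq_eqVlt => /predU1P[gB|gB]; last exact: Gs.
    by have -> : B = A by apply: ginj; rewrite ?inE ?gA.
  apply: filterS IHn => s Gs B [FB].
  rewrite ltnS leq_eqVlt => /predU1P[gB|gB]; last exact: Gs.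
  by case: nA; exists B.
- by move=> m n mn s Gs B [FB gB]; apply: Gs; split=> //; exact: leq_trans mn.
- by move=> s Gs B FB; apply: (Gs (g B).+1).
Qed.

(** One of the closed neighborhoods of [x] attached to the complement of
    [{e}] misses [e]; its complement is an open set around [e], to which the
    axiom applies in turn. *)
Lemma T2delta_separated_closed_nbhs (Z : topologicalType) (x e : Z) :
  T2delta_space Z -> x <> e ->
  exists (B : set Z) (G : nat -> set Z),
    [/\ closed B /\ nbhs x B, forall n, closed (G n), forall n, nbhs e (G n),
        forall m n, m <= n -> G n `<=` G m &
        forall s, B s -> ~ forall n, G n s].
Proof.
move=> [T1 T2d] xe.
have [F [_ FP Fe]] : exists F : set (set Z), [/\ countable F,
    forall B, F B -> closed B /\ nbhs x B & \bigcap_(B in F) B `<=` ~` [set e]].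
  by apply: T2d => //; apply: closed_openC; exact: accessible_closed_set1.
have [B FB nBe] : exists2 B, F B & ~ B e.
  apply: contrapT => nB; apply: (Fe e) => // B FB.
  by apply: contrapT => nBe; apply: nB; exists B.
have [clB Bx] := FP B FB.
have [F' [F'c F'P F'B]] := T2d (~` B) e (closed_openC clB) nBe.
have [G [clG Ge dG Gsub]] := countable_closed_nbhs_sequence F'c F'P.
exists B, G; split=> // s Bs Gs; apply: (F'B s) => //.
by apply: Gsub => n _; exact: Gs.
Qed.

Lemma separated_closed_nbhs (Z : topologicalType) (x e : Z) :
  vecT2delta_space Z -> x <> e ->
  exists (B : set Z) (G : nat -> set Z),
    [/\ closed B /\ nbhs x B, forall n, closed (G n), forall n, nbhs e (G n),
        forall m n, m <= n -> G n `<=` G m &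
        forall s, B s -> ~ forall n, G n s].
Proof.
move=> [W [f [fbij fc T2d]]] xe.
have [|B [G [[clB Bx] clG Ge dG BG]]] :=
  @T2delta_separated_closed_nbhs W (f x) (f e) T2d.
  by move/(bij_inj fbij).
exists (f @^-1` B), (fun n => f @^-1` G n); split.
- by split; [apply: preimage_closed => // s _; exact: fc|exact: fc].
- by move=> n; apply: preimage_closed => // s _; exact: fc.
- by move=> n; exact: fc.
- by move=> m n mn s; exact: dG.
- by move=> s; exact: BG.
Qed.

(** * Closedness of the order *)

Theorem theorem5 (X : topologicalType) (op : X -> X -> X)
    (semitopX : is_semitopological_semilattice op)
    (completeX : complete_semilattice op)
    (sepX : vecT2delta_space X) :
  closed [set p : X * X | op p.1 p.2 = p.1].
Proof.
move=> [x y] clxy /=; apply: contrapT => xyx.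
have sl := semitop_semilattice semitopX.
have [|B [G [[clB Bx] clG Gxy dG BG]]] :=
  @separated_closed_nbhs X x (op x y) sepX.
  by move=> xE; apply: xyx.
have [a [b [ab Ba Gb]]] :=
  @exists_window_sequences X op x y B° (fun n => (G n)°) semitopX clxy
    (open_interior B) Bx (fun n => open_interior (G n)) Gxy.
have [|m j|s [Bs Gs]] :=
  @window_products_common_limit X op a b B G sl completeX clB clG dG ab.
- by move=> m j; exact: interior_subset (Ba m j).
- exact: interior_subset (Gb m j).
exact: BG Bs Gs.
Qed.
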